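(* If an integral domain $R$ is MCD-finite, then the polynomial ring $R[x]$ is also MCD-finite.
   Context: For an integral domain $R$ and a nonempty finite subset $S$ of $R^*=R\setminus\{0\}$, a common divisor $d\in R^*$ of $S$ is a maximal common divisor (MCD) of $S$ if the only common divisors of $\{s/d : s\in S\}$ in $R$ are the units of $R$. $R$ is MCD-finite if every nonempty finite subset of $R^*$ has only finitely many MCDs up to associates (possibly none). *)

(* Defs.v *)
From mathcomp Require Import all_boot all_algebra.
From mathcomp Require Import boolp classical_sets functions cardinality.

Set Implicit Arguments.
Unset Strict Implicit.
Unset Printing Implicit Defensive.

Import GRing.Theory.
Local Open Scope classical_set_scope.
Local Open Scope ring_scope.

Section MCD.
Variable R : idomainType.
Implicit Types (a b d : R) (S : set R).

(* The library's [%|] and [%=] on {poly R} are pseudo-division notions: they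
   ignore nonzero scalar factors, so they are not divisibility and
   associatedness in the ring {poly R} unless R is a field. *)
Definition divides d a : Prop := exists c, a = c * d.

Definition associates a b : Prop := exists2 u, u \is a GRing.unit & b = u * a.

Definition common_divisor S d : Prop :=
  d != 0 /\ forall s, S s -> divides d s.

(* {s / d : s in S}, for d a nonzero divisor of every element of S; the
   quotient s / d is the unique c with s = c * d. ([s / d] in MathComp is
   multiplication by d^-1, meaningful only when d is a unit.) *)
Definition quotients S d : set R := [set c | exists2 s, S s & s = c * d].

Definition is_MCD S d : Prop :=
  common_divisor S d /\
  forall e, common_divisor (quotients S d) e -> e \is a GRing.unit.

Definition associate_class a : set R := [set b | associates a b].

Definition MCD_finite : Prop :=
  forall S, finite_set S -> S !=set0 -> S `<=` [set s | s != 0] ->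
    finite_set [set associate_class d | d in [set d | is_MCD S d]].

End MCD.

(* Main.v *)
(** Up to associates over the fraction field [K], an element of [S] has only
    finitely many divisors, so it is enough to bound the MCDs of [S] which are
    [K]-multiples of one of them, [g]. If [b] is the leading coefficient of [g],
    such an MCD [d] with leading coefficient [a] satisfies [b d = a g], so
    [s / d] is [b (s / g) / a]; hence [a] is an MCD, in [R], of the nonzero
    coefficients of the polynomials [b (s / g)], a finite set which does not
    depend on [d]. There are finitely many such [a] up to associates, and [a]
    determines [d] up to associates. *)

Require Import Defs.
From mathcomp Require Import all_boot all_algebra.
From mathcomp Require Import boolp classical_sets functions cardinality.

Set Implicit Arguments.
Unset Strict Implicit.
Unset Printing Implicit Defensive.

Import GRing.Theory Pdiv.Idomain.
Local Open Scope classical_set_scope.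
Local Open Scope ring_scope.

Section Associates.
Variable R : idomainType.
Implicit Types a b c : R.

Lemma associates_refl a : associates a a.
Proof. by exists 1; rewrite ?unitr1 ?mul1r. Qed.

Lemma associates_sym a b : associates a b -> associates b a.
Proof. by case=> u uU ->; exists u^-1; rewrite ?unitrV // mulKr. Qed.

Lemma associates_trans a b c :
  associates a b -> associates b c -> associates a c.
Proof. by case=> u uU -> [v vU ->]; exists (v * u); rewrite ?unitrM ?vU ?mulrA. Qed.

Lemma associate_classP a b :
  associate_class a = associate_class b <-> associates a b.
Proof.
split=> [eq_ab|ab].
  have : associate_class b b by apply: associates_refl.
  by rewrite -eq_ab.
apply/seteqP; split=> c; last exact: associates_trans.
by apply: associates_trans; apply: associates_sym.
Qed.

End Associates.

(** On [A], [g] factors through [f], so each of the finitely many fibres of [f] contributes a single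
    value of [g]. *)
Lemma finite_image_factor (T U V : Type) (A : set T) (f : T -> U) (g : T -> V) :
    (forall x y, A x -> A y -> f x = f y -> g x = g y) ->
  finite_set (f @` A) -> finite_set (g @` A).
Proof.
move=> fg finf; pose F u := g @` [set x | A x /\ f x = u].
apply: (@sub_finite_set _ _ (\bigcup_(u in f @` A) F u)) => [_ [x Ax <-]|].
  by exists (f x); [exists x | exists x].
apply: bigcup_finite => // _ [x Ax <-].
apply: (@sub_finite_set _ _ [set g x]); last exact: finite_set1.
by move=> _ [y [Ay fyx] <-] /=; apply: fg.
Qed.

Section PolyDivisors.
Variable R : idomainType.
Implicit Types p q r d : {poly R}.

(** Take [d1] to be the gcd of [d] and [q]: the cofactor of [d1] in [d] is coprime to that in [q],
    so Gauss's lemma forces it to divide [r]. Pseudo-division makes each factorization hold only up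
    to scalars. *)
Lemma dvdp_mul_decomp d q r : d != 0 -> d %| q * r ->
  exists d1 d2, [/\ d1 %| q, d2 %| r & d %= d1 * d2].
Proof.
move=> d0 d_qr; set g := gcdp d q.
have gd : g %| d := dvdp_gcdl d q.
have gq : g %| q := dvdp_gcdr d q.
have g0 : g != 0 by rewrite gcdp_eq0 (negPf d0).
have lg0 n : lead_coef g ^+ n != 0 by rewrite expf_neq0 ?lead_coef_eq0.
have eq_d : d %/ g * g %= d by rewrite (divpK gd) eqp_scale.
have eq_q : q %/ g * g %= q by rewrite (divpK gq) eqp_scale.
exists g, (d %/ g); split=> //; last by rewrite mulrC eqp_sym.
have copr : coprimep (d %/ g) (q %/ g) by rewrite coprimep_div_gcd ?d0.
rewrite -(Gauss_dvdpr _ copr) -(dvdp_mul2r _ _ g0) mulrAC.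
by rewrite (eqp_dvdl _ eq_d) (eqp_dvdr _ (eqp_mulr r eq_q)).
Qed.

(* [%=] is associatedness over the fraction field of [R]. *)
Lemma dvdp_finite_eqp p : p != 0 ->
  exists l : seq {poly R}, forall d, d %| p -> exists2 g, g \in l & d %= g.
Proof.
have [n] := ubnP (size p); elim: n p => // n IHn p; rewrite ltnS => le_pn p0.
(* Either [p] splits, up to a scalar, into two factors of smaller size, and its divisors are
   products of theirs, or [1] and [p] are its only divisors up to [%=]. *)
have [[q [qp q1 qp']]|irr_p] :=
    pselect (exists q, [/\ q %| p, ~~ (q %= 1) & ~~ (q %= p)]); last first.
  exists [:: 1; p] => d dp; have [d1|d1] := boolP (d %= 1).
    by exists 1; rewrite ?inE ?eqxx.
  have [d2|d2] := boolP (d %= p); first by exists p; rewrite ?inE ?eqxx ?orbT.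
  by case: irr_p; exists d.
have [[c r] /= c0 def_p] := dvdpP _ _ qp.
have rq0 : r * q != 0 by rewrite -def_p scale_poly_eq0 negb_or c0.
have [r0 q0] : r != 0 /\ q != 0 by apply/andP; rewrite -negb_or -mulf_eq0.
have sz_q : (size q < size p)%N.
  by rewrite ltn_neqAle (dvdp_leq p0 qp) (dvdp_size_eqp qp) qp'.
have sz_r : (size r < size p)%N.
  have q_gt1 : (1 < size q)%N.
    by rewrite ltn_neqAle eq_sym size_poly_eq1 q1 size_poly_gt0.
  rewrite -(size_scale p c0) def_p size_mul //.
  by case: (size q) q_gt1 => [|[|m]] // _; rewrite !addnS /= ltnS leq_addr.
have [lr Hr] := IHn r (leq_trans sz_r le_pn) r0.
have [lq Hq] := IHn q (leq_trans sz_q le_pn) q0.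
exists [seq u * v | u <- lr, v <- lq] => d dp.
have d0 : d != 0 by apply: contraNneq p0 => d_0; rewrite -dvd0p -d_0.
have : d %| r * q by rewrite -def_p dvdpZr.
case/(dvdp_mul_decomp d0)=> d1 [d2 [/Hr[u ulr d1u] /Hq[v vlq d2v] d12]].
exists (u * v); first by apply/allpairsP; exists (u, v).
by rewrite (eqp_ltrans d12) (eqp_ltrans (eqp_mulr d2 d1u)) eqp_mull.
Qed.

Lemma divides_dvdp d p : divides d p -> d %| p.
Proof. by case=> c ->; apply: dvdp_mulIr. Qed.

Lemma divides_polyC (e : R) p :
  (forall i, p`_i != 0 -> divides e p`_i) -> divides e%:P p.
Proof.
move=> e_p; have /choice[c def_c] i : exists c, p`_i = c * e.
  have [->|/e_p//] := eqVneq p`_i 0; by exists 0; rewrite mul0r.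
exists (\poly_(i < size p) c i); apply/polyP=> i.
rewrite coefMC coef_poly; case: ltnP => [_|le_pi]; first exact: def_c.
by rewrite nth_default ?mul0r.
Qed.

Lemma unit_polyC (e : R) : e%:P \is a GRing.unit -> e \is a GRing.unit.
Proof. by rewrite poly_unitE coefC => /andP[]. Qed.

Lemma eqp_lead_coefZ d q :
  d != 0 -> d %= q -> lead_coef q *: d = lead_coef d *: q.
Proof.
move=> d0 /eqpP[[c1 c2] /= /andP[c10 c20] eq_c].
have eq_l : c1 * lead_coef d = c2 * lead_coef q by rewrite -!lead_coefZ eq_c.
have c1P : c1%:P != 0 by rewrite polyC_eq0.
apply: (mulfI c1P); rewrite !mul_polyC !scalerA eq_l.
by rewrite [c1 * _]mulrC [c2 * _]mulrC -!scalerA eq_c.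
Qed.

(** Here [h] stands for the quotient of an element of [S] by [g]. Zero coefficients are left out
    because [MCD_finite] only concerns sets of nonzero elements. *)
Definition scaled_quotient_coefs (S : set {poly R}) g : set R :=
  [set c | c != 0 /\ exists h i, S (h * g) /\ c = lead_coef g * h`_i].

Lemma finite_scaled_quotient_coefs (S : set {poly R}) g : g != 0 ->
  finite_set S -> finite_set (scaled_quotient_coefs S g).
Proof.
move=> g0 finS; pose F s := [set c | c != 0 /\
  exists h i, s = h * g /\ c = lead_coef g * h`_i].
apply: (@sub_finite_set _ _ (\bigcup_(s in S) F s)).
  by move=> c [c0 [h [i [Shg def_c]]]]; exists (h * g); [|split; [|exists h, i]].
apply: bigcup_finite => // s _.
have [[h def_s]|no_h] := pselect (divides g s); last first.
  apply: (@sub_finite_set _ _ set0) => // c [_ [h [i [def_s _]]]].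
  by case: no_h; exists h.
(* Cancelling [g] makes the quotient [h] unique, so only the coefficients of one polynomial can
   occur. *)
apply: (@sub_finite_set _ _ [set` (lead_coef g *: h : seq R)]).
  move=> c [c0 [h' [i [def_s' def_c]]]] /=.
  have eq_h : h' = h by apply: (mulIf g0); rewrite -def_s -def_s'.
  have {}def_c : c = (lead_coef g *: h)`_i by rewrite coefZ def_c eq_h.
  rewrite def_c mem_nth // ltnNge; apply: contra c0 => le_i.
  by rewrite def_c nth_default.
exact: finite_seq.
Qed.

Lemma is_MCD_lead_coef (S : set {poly R}) g d :
    common_divisor S g -> lead_coef g *: d = lead_coef d *: g -> is_MCD S d ->
  is_MCD (scaled_quotient_coefs S g) (lead_coef d).
Proof.
move=> [g0 gS] dg [[d0 dS] maxd].
have lg0 : lead_coef g != 0 by rewrite lead_coef_eq0.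
have ld0 : lead_coef d != 0 by rewrite lead_coef_eq0.
have eq_quo h k : h * g = k * d -> lead_coef g *: h = lead_coef d *: k.
  move=> hk; apply: (mulIf g0).
  by rewrite -scalerAl hk -scalerAl [in RHS]scalerAr -dg -scalerAr.
split=> [|e [e0 eT]].
  split=> // _ [_ [h [i [/[dup] Shg /dS[k hk] ->]]]].
  by exists k`_i; rewrite -coefZ (eq_quo h k) // coefZ mulrC.
(* As a constant polynomial, [e] divides every coefficient of every quotient of [S] by [d], so
   maximality of [d] makes it a unit. *)
apply/unit_polyC/maxd; split; first by rewrite polyC_eq0.
move=> k [s Ss def_s]; apply: divides_polyC => i ki0.
apply: eT; exists (lead_coef d * k`_i).
  have [h def_h] := gS s Ss; split; first by rewrite mulf_neq0.
  exists h, i; rewrite -def_h -coefZ -(eq_quo h k) ?coefZ //.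
  by rewrite -def_h.
by rewrite mulrC.
Qed.

(** If the leading coefficients differ by the unit [u], then [lead_coef g *: d'] is [u] times
    [lead_coef g *: d], and [lead_coef g] cancels. *)
Lemma associates_lead_coef g d d' : g != 0 ->
    lead_coef g *: d = lead_coef d *: g ->
    lead_coef g *: d' = lead_coef d' *: g ->
  associates (lead_coef d) (lead_coef d') -> associates d d'.
Proof.
move=> g0 dg d'g [u uU eq_u]; exists u%:P; first by rewrite rmorph_unit.
have lg0 : (lead_coef g)%:P != 0 by rewrite polyC_eq0 lead_coef_eq0.
apply: (mulfI lg0); rewrite mulrCA !mul_polyC d'g eq_u dg.
by rewrite scalerA.
Qed.

End PolyDivisors.

Theorem theorem4p2 (R : idomainType) (R_mcd : MCD_finite R) :
  MCD_finite {poly R}.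
Proof.
move=> S finS [s0 Ss0] S0.
have [l dvd_l] := dvdp_finite_eqp (S0 _ Ss0).
pose A q := [set d | is_MCD S d /\ d %= q].
have MCD_l : [set d | is_MCD S d] `<=` \bigcup_(q in [set` l]) A q.
  move=> d Sd; have [q lq dq] := dvd_l d (divides_dvdp (Sd.1.2 _ Ss0)).
  by exists q.
apply: (sub_finite_set (image_subset _ MCD_l)).
rewrite image_bigcup; apply: bigcup_finite => [|q _]; first exact: finite_seq.
(* The representative [q] need not be an MCD of [S], so a member [g] of its class replaces it as
   reference. *)
have [->|/set0P[g [Sg gq]]] := eqVneq (A q) set0; first by rewrite image_set0.
have g0 : g != 0 := Sg.1.1.
have Ag d : A q d -> lead_coef g *: d = lead_coef d *: g.
  move=> [Sd dq]; apply: eqp_lead_coefZ; first exact: Sd.1.1.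
  by rewrite (eqp_ltrans dq) eqp_sym.
apply: (@finite_image_factor _ _ _ _ (fun d => associate_class (lead_coef d))).
  move=> d d' Ad Ad' /associate_classP dd'; apply/associate_classP.
  exact: (associates_lead_coef g0 (Ag d Ad) (Ag d' Ad')).
apply: (@sub_finite_set _ _
    (@associate_class R @` [set a | is_MCD (scaled_quotient_coefs S g) a])).
  move=> _ [d Ad <-]; exists (lead_coef d) => //.
  exact: (is_MCD_lead_coef Sg.1 (Ag d Ad) Ad.1).
apply: R_mcd; first exact: finite_scaled_quotient_coefs.
- have [h def_s0] := Sg.1.2 _ Ss0.
  have h0 : h != 0.
    by apply: contraNneq (S0 _ Ss0) => h_0; rewrite def_s0 h_0 mul0r.
  (* The coefficient set is nonempty: it contains the leading coefficient of [lead_coef g *: h],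
     found at index [(size h).-1]. *)
  exists (lead_coef g * lead_coef h); split.
    by rewrite mulf_neq0 ?lead_coef_eq0.
  by exists h, (size h).-1; rewrite -def_s0.
- by move=> c [].
Qed.
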